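(* If $\tau=1020$ or $\tau=1022$, then $$f_\tau(x)=\frac{1-9x+32x^2-56x^3+49x^4-19x^5+x^6}{(1-x)(1-2x)^3(1-3x+x^2)}$$ as formal power series in $x$, where $f_\tau(x)=\sum_{n\ge 0} b_n(\tau)x^n$ and $b_n(\tau)$ is the number of ascent sequences of length $n$ that avoid both patterns $021$ and $\tau$.
   Context: For a finite sequence $w=w_1\cdots w_n$ of integers, $\mathrm{asc}(w)$ is the number of indices $1\le i\le n-1$ with $w_i<w_{i+1}$. An ascent sequence of length $n\ge 1$ is a sequence $a_1\cdots a_n$ of non-negative integers such that $a_1=0$ and $a_i\le \mathrm{asc}(a_1\cdots a_{i-1})+1$ for $1<i\le n$; there is exactly one (empty) ascent sequence of length $0$. A sequence $\pi=\pi_1\cdots\pi_n$ contains a pattern $\tau=\tau_1\cdots\tau_m$ if there are indices $1\le i_1<\cdots<i_m\le n$ such that for all $j,k\in\{1,\dots,m\}$: $\pi_{i_j}<\pi_{i_k}$ iff $\tau_j<\tau_k$, and $\pi_{i_j}=\pi_{i_k}$ iff $\tau_j=\tau_k$; otherwise $\pi$ avoids $\tau$. For a pattern $\tau$, $B_n(\tau)$ is the set of ascent sequences of length $n$ avoiding both $021$ and $\tau$ (with $B_0(\tau)$ consisting of the empty sequence), and $b_n(\tau)=|B_n(\tau)|$. *)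

(* Defs.v *)
From mathcomp Require Import all_boot all_order all_algebra.

Set Implicit Arguments.
Unset Strict Implicit.
Unset Printing Implicit Defensive.

Import GRing.Theory.

(* Sequences are 0-indexed: the informal w_(i+1) is nth 0 w i. *)

Definition asc (w : seq nat) : nat :=
  \sum_(i < (size w).-1) (nth 0 w i < nth 0 w i.+1).

(* The prefix strictly before position i is take i w.  On the empty sequence
   both conditions hold (nth returns its default 0), so it is the unique
   ascent sequence of length 0. *)
Definition ascent_seq (w : seq nat) : bool :=
  (nth 0 w 0 == 0) &&
  [forall i : 'I_(size w), (0 < i) ==> (nth 0 w i <= asc (take i w) + 1)].

Definition contains (p t : seq nat) : bool :=
  [exists f : {ffun 'I_(size t) -> 'I_(size p)},
    [forall j : 'I_(size t), forall k : 'I_(size t),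
      [&& (j < k) ==> (f j < f k),
          (nth 0 p (f j) < nth 0 p (f k)) == (nth 0 t j < nth 0 t k) &
          (nth 0 p (f j) == nth 0 p (f k)) == (nth 0 t j == nth 0 t k)]]].

Definition avoids (p t : seq nat) : bool := ~~ contains p t.

Definition in_B (t : seq nat) (n : nat) (w : seq nat) : bool :=
  [&& size w == n, ascent_seq w, avoids w [:: 0; 2; 1] & avoids w t].

(* The entries of an ascent sequence of length n are all smaller than n
   (ascent_seq_lt below), so B_n(t) can be counted inside n.-tuple 'I_n;
   card_B shows that nothing is lost. *)
Definition b (t : seq nat) (n : nat) : nat :=
  #|[set w : n.-tuple 'I_n | in_B t n (map val w)]|.

Lemma asc_lt (w : seq nat) : asc w <= (size w).-1.
Proof.
rewrite /asc -[X in _ <= X]card_ord -sum1_card.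
by apply: leq_sum => i _; case: (_ < _).
Qed.

Lemma ascent_seq_lt (w : seq nat) :
  ascent_seq w -> all (fun x => x < size w) w.
Proof.
case/andP=> /eqP w0 /forallP aw; apply/(all_nthP 0) => i lt_iw.
have [->|i_gt0] := posnP i; first by rewrite w0; apply: leq_trans lt_iw.
have /implyP/(_ i_gt0)/= le_i := aw (Ordinal lt_iw).
apply: leq_ltn_trans le_i _; rewrite addn1.
apply: leq_ltn_trans (lt_iw); rewrite -[X in _ < X](prednK i_gt0) ltnS.
by apply: leq_trans (asc_lt _) _; rewrite size_take lt_iw.
Qed.

Lemma card_B (t : seq nat) (n : nat) (s : seq (seq nat)) :
  uniq s -> (forall w, (w \in s) = in_B t n w) -> b t n = size s.
Proof.
move=> s_uniq sE; rewrite /b cardE.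
set e := enum _; rewrite -(size_map (fun w : n.-tuple 'I_n => map val w)).
apply/perm_size/uniq_perm => //.
  rewrite map_inj_uniq ?enum_uniq // => u v /(inj_map val_inj) uv.
  exact: val_inj.
move=> w; rewrite sE; apply/mapP/idP => [[u + ->]|Bw].
  by rewrite mem_enum inE.
have /andP[/eqP szw /andP[aw _]] := Bw.
have := ascent_seq_lt aw; rewrite szw => ltw.
have szu : size (pmap insub w : seq 'I_n) == n.
  rewrite size_pmap_sub -[X in _ == X]szw -all_count.
  exact: ltw.
have wE : w = map val (Tuple szu).
  rewrite /= (pmap_filter (@insubK _ _ _)); symmetry; apply/all_filterP.
  by apply: sub_all ltw => x ltx /=; rewrite insubT.
by exists (Tuple szu); rewrite // mem_enum inE -wE.
Qed.

Local Open Scope ring_scope.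

(* A formal power series is the sequence of its coefficients. *)
Definition fps (R : Type) := nat -> R.

Definition fps_of_poly (R : nzRingType) (p : {poly R}) : fps R := fun n => p`_n.

Definition fps_mul (R : nzRingType) (f g : fps R) : fps R :=
  fun n => \sum_(i < n.+1) f i * g (n - i)%N.

(* Long division: given the coefficients q_0, ..., q_(m-1) of f / g, append
   q_m = (f_m - \sum_(i < m) q_i g_(m-i)) / g_0.  This is meaningful when
   g_0 != 0, i.e. when g is invertible; see fps_divP. *)
Definition fps_div_step (F : fieldType) (f g : fps F) (s : seq F) : seq F :=
  let m := size s in
  rcons s ((f m - \sum_(i < m) s`_i * g (m - i)%N) / g 0%N).

Definition fps_div (F : fieldType) (f g : fps F) : fps F :=
  fun n => (iter n.+1 (fps_div_step f g) [::])`_n.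

Lemma size_fps_div_iter (F : fieldType) (f g : fps F) (n : nat) :
  size (iter n (fps_div_step f g) [::]) = n.
Proof. by elim: n => //= n IHn; rewrite size_rcons IHn. Qed.

Lemma nth_fps_div_iter (F : fieldType) (f g : fps F) (n i : nat) :
  (i < n)%N -> (iter n (fps_div_step f g) [::])`_i = fps_div f g i.
Proof.
elim: n => // n IHn; rewrite ltnS leq_eqVlt => /predU1P[->//|lt_in].
by rewrite iterS /fps_div_step nth_rcons size_fps_div_iter lt_in IHn.
Qed.

Lemma fps_divE (F : fieldType) (f g : fps F) (n : nat) :
  fps_div f g n =
    (f n - \sum_(i < n) fps_div f g i * g (n - i)%N) / g 0%N.
Proof.
rewrite {1}/fps_div iterS {1}/fps_div_step nth_rcons size_fps_div_iter.
rewrite ltnn eqxx; congr ((_ - _) / _).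
by apply: eq_bigr => i _; rewrite nth_fps_div_iter.
Qed.

Lemma fps_divP (F : fieldType) (f g h : fps F) :
  g 0%N != 0 -> h =1 fps_div f g <-> fps_mul h g =1 f.
Proof.
move=> g0; split=> [hE n|hgE n].
  rewrite /fps_mul big_ord_recr /= subnn hE fps_divE divfK //.
  by rewrite addrC -addrA [- _ + _]addrC; under eq_bigr do rewrite hE;
     rewrite subrr addr0.
elim/ltn_ind: n => n IHn; rewrite fps_divE -hgE /fps_mul big_ord_recr /= subnn.
rewrite addrC; under [X in _ - X]eq_bigr => i _ do rewrite -IHn //.
by rewrite addrK mulfK.
Qed.

Definition f_gen (t : seq nat) : fps rat := fun n => (b t n)%:R.

(* Main.v *)
(* An ascent sequence avoids 021 iff its nonzero letters increase weakly.  Such a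
   word contains 1020 iff it contains 1 0 m 0, and 1022 iff it contains 1 0 m m, for
   some m > 1, where m may be taken to be the maximum of the shortest prefix
   containing the pattern.  So whether a letter may be appended depends only on
   the maximum m, the number of ascents, and whether 1 0 m occurs, and B_n is the
   set of words of length n accepted by a deterministic automaton.  The number of completions of a word containing 1 0 m depends only
   on its slack (ascents minus maximum) and is the same for both patterns; this
   turns the automaton into a linear system for power series, which is solved
   coefficientwise. *)
Require Import Defs.
From mathcomp Require Import all_boot all_order all_algebra.
From mathcomp Require Import zify ring lra.

Import GRing.Theory.

(** * Pattern containment in terms of subsequences *)

Lemma containsP (p t : seq nat) :
  contains p t <->
  exists2 s, subseq s p & size s = size t /\
    forall j k, j < size t -> k < size t ->
      (nth 0 s j < nth 0 s k) = (nth 0 t j < nth 0 t k) /\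
      (nth 0 s j == nth 0 s k) = (nth 0 t j == nth 0 t k).
Proof.
split=> [/existsP[f /'forall_forallP fP]|[s]].
- set idx := [seq val (f j) | j <- enum 'I_(size t)].
  have sz_idx : size idx = size t by rewrite size_map size_enum_ord.
  have nth_idx j (lt_jt : j < size t) : nth 0 idx j = f (Ordinal lt_jt).
    by rewrite (nth_map (Ordinal lt_jt)) ?size_enum_ord // (nth_ord_enum _ (Ordinal lt_jt)).
  exists [seq nth 0 p i | i <- idx].
    rewrite -[X in subseq _ X](mkseq_nth 0) map_subseq //.
    (* A strictly increasing list is determined by its members, so the positions chosen by [f] form
       a filter of [iota]. *)
    suff -> : idx = [seq i <- iota 0 (size p) | i \in idx] by apply: filter_subseq.
    apply: (irr_sorted_eq ltn_trans ltnn).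
    - apply/(sortedP 0) => i; rewrite sz_idx => lt_it.
      have lt_i := ltnW lt_it; rewrite !nth_idx.
      by have /and3P[/implyP-> //] := fP (Ordinal lt_i) (Ordinal lt_it).
    - by rewrite sorted_filter ?iota_ltn_sorted //; apply: ltn_trans.
    move=> i; rewrite mem_filter mem_iota add0n /=.
    by case: mapP => //= -[j _ ->]; rewrite ltn_ord.
  rewrite size_map sz_idx; split=> // j k lt_j lt_k.
  rewrite !(nth_map 0) ?sz_idx // !nth_idx.
  by have /and3P[_ /eqP-> /eqP->] := fP (Ordinal lt_j) (Ordinal lt_k).
rewrite -{1}(mkseq_nth 0 p) => /subseqP[m]; rewrite size_map size_iota => szm.
rewrite /mkseq -map_mask; set idx := mask _ _ => -> [].
rewrite size_map => sz_idx sP.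
have lt_idx (j : 'I_(size t)) : nth 0 idx j < size p.
  have: nth 0 idx j \in idx by rewrite mem_nth // sz_idx.
  by move/mem_mask; rewrite mem_iota.
apply/existsP; exists [ffun j => Ordinal (lt_idx j)].
apply/'forall_forallP => j k; rewrite !ffunE /=.
have := sP j k (ltn_ord j) (ltn_ord k).
rewrite !(nth_map 0) ?sz_idx // => -[-> ->]; rewrite !eqxx !andbT.
apply/implyP => lt_jk; apply: (sorted_ltn_nth ltn_trans); rewrite ?inE ?sz_idx //.
by apply: sorted_mask; [exact: ltn_trans | exact: iota_ltn_sorted].
Qed.

Lemma contains021P (p : seq nat) :
  contains p [:: 0; 2; 1] <->
  exists x y z, subseq [:: x; y; z] p /\ x < z < y.
Proof.
split=> [/containsP[s + [+ sP]]|[x [y [z [sub /andP[? ?]]]]]].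
  case: s sP => [|x [|y [|z []]]] //= sP sub _; exists x, y, z; split=> //.
  by have [/= -> _] := sP 0 2 erefl erefl; have [/= -> _] := sP 2 1 erefl erefl.
apply/containsP; exists [:: x; y; z] => //; split=> //= j k.
by do 3?[case: j => [|j]]; do 3?[case: k => [|k]] => //=; lia.
Qed.

Lemma contains1020P (p : seq nat) :
  contains p [:: 1; 0; 2; 0] <->
  exists x y z, subseq [:: x; y; z; y] p /\ y < x < z.
Proof.
split=> [/containsP[s + [+ sP]]|[x [y [z [sub /andP[? ?]]]]]].
  case: s sP => [|x [|y [|z [|u []]]]] //= sP sub _; exists x, y, z.
  have [_ /= /eqP yu] := sP 1 3 erefl erefl.
  have [/= -> _] := sP 1 0 erefl erefl; have [/= -> _] := sP 0 2 erefl erefl.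
  by rewrite [X in [:: _; _; _; X]]yu.
apply/containsP; exists [:: x; y; z; y] => //; split=> //= j k.
by do 4?[case: j => [|j]]; do 4?[case: k => [|k]] => //=; lia.
Qed.

Lemma contains1022P (p : seq nat) :
  contains p [:: 1; 0; 2; 2] <->
  exists x y z, subseq [:: x; y; z; z] p /\ y < x < z.
Proof.
split=> [/containsP[s + [+ sP]]|[x [y [z [sub /andP[? ?]]]]]].
  case: s sP => [|x [|y [|z [|u []]]]] //= sP sub _; exists x, y, z.
  have [_ /= /eqP zu] := sP 2 3 erefl erefl.
  have [/= -> _] := sP 1 0 erefl erefl; have [/= -> _] := sP 0 2 erefl erefl.
  by rewrite [X in [:: _; _; _; X]]zu.
apply/containsP; exists [:: x; y; z; z] => //; split=> //= j k.
by do 4?[case: j => [|j]]; do 4?[case: k => [|k]] => //=; lia.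
Qed.

(** * Appending a letter; ascents and maxima *)

Lemma asc_rcons (w : seq nat) (a : nat) :
  w != [::] -> asc (rcons w a) = asc w + (last 0 w < a).
Proof.
case: w => // x w _; rewrite /asc size_rcons /= big_ord_recr /=.
congr (_ + _); last first.
  by rewrite -rcons_cons !nth_rcons /= ltnSn ltnn eqxx -last_nth.
apply: eq_bigr => i _; rewrite -rcons_cons !nth_rcons /= ltnS (ltnW (ltn_ord i)).
by rewrite ltn_ord.
Qed.

Lemma ascent_seqP (w : seq nat) :
  reflect (nth 0 w 0 = 0 /\ forall i, 0 < i < size w -> nth 0 w i <= (asc (take i w)).+1)
    (ascent_seq w).
Proof.
apply: (iffP andP) => [[/eqP w0 /forallP aP]|[/eqP w0 aP]]; split=> //.
  move=> i /andP[i_gt0 lt_i]; have /implyP/(_ i_gt0) := aP (Ordinal lt_i).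
  by rewrite addn1.
by apply/forallP => i; apply/implyP => i_gt0; rewrite addn1 aP ?i_gt0 /=.
Qed.

Lemma ascent_seq_rcons (w : seq nat) (a : nat) :
  w != [::] -> ascent_seq (rcons w a) = ascent_seq w && (a <= (asc w).+1).
Proof.
move=> w0; have w_gt0 : 0 < size w by rewrite lt0n size_eq0.
have take_rcons i : i <= size w -> take i (rcons w a) = take i w.
  by move=> le_i; rewrite -cats1 takel_cat.
apply/ascent_seqP/andP; rewrite nth_rcons w_gt0 size_rcons => -[].
  move=> a0 aP; split.
    apply/ascent_seqP; split=> // i /andP[i_gt0 lt_i].
    have := aP i; rewrite i_gt0 ltnS (ltnW lt_i) nth_rcons lt_i.
    by rewrite take_rcons ?(ltnW lt_i) //; apply.
  have := aP (size w); rewrite w_gt0 ltnSn nth_rcons ltnn eqxx.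
  by rewrite take_rcons // take_size; apply.
move=> /ascent_seqP[a0 aP] a_le; split=> // i /andP[i_gt0].
rewrite ltnS => le_i; rewrite take_rcons // nth_rcons.
move: le_i; rewrite leq_eqVlt; case: eqVneq => [-> _|_ /= lt_i].
  by rewrite ltnn take_size.
by rewrite lt_i aP // i_gt0.
Qed.

(** Reversal turns the greedy matching of [subseq] from the left into one from the right. *)
Lemma subseq_rcons_rcons (T : eqType) (s w : seq T) (y a : T) :
  subseq (rcons s y) (rcons w a) = subseq (if y == a then s else rcons s y) w.
Proof.
by rewrite -subseq_rev !rev_rcons /= -(subseq_rev _ w); case: eqP; rewrite ?rev_rcons.
Qed.

Lemma subseq_prefix (T : eqType) (s w : seq T) (a : T) : subseq (rcons s a) w -> subseq s w.
Proof. by apply: subseq_trans; rewrite -cats1 prefix_subseq. Qed.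

Definition seq_max (w : seq nat) : nat := \max_(x <- w) x.

Lemma seq_max_rcons (w : seq nat) (a : nat) : seq_max (rcons w a) = maxn (seq_max w) a.
Proof. by rewrite /seq_max big_rcons. Qed.

Lemma leq_seq_max (w : seq nat) (x : nat) : x \in w -> x <= seq_max w.
Proof. by move=> xw; apply: (@leq_bigmax_seq _ _ xpredT id). Qed.

Lemma seq_max_leqP (w : seq nat) (m : nat) : reflect {in w, forall x, x <= m} (seq_max w <= m).
Proof.
by apply: (iffP (bigmax_leqP_seq _ _ _ _)) => H x xw; [apply: H | move=> _; apply: H].
Qed.

Lemma seq_max_mem (w : seq nat) : 0 < seq_max w -> seq_max w \in w.
Proof.
elim/last_ind: w => [|w a IHw]; first by rewrite /seq_max big_nil.
rewrite seq_max_rcons mem_rcons inE.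
by case: (leqP (seq_max w) a) => [|lt_a] max_gt0; rewrite ?eqxx // IHw ?orbT.
Qed.

Lemma last_leq_seq_max (w : seq nat) : last 0 w <= seq_max w.
Proof. by case/lastP: w => [|w a] //; rewrite last_rcons seq_max_rcons leq_maxr. Qed.

(** A letter above the maximum is also above the last letter, so it adds an ascent, and it exceeds
    the old number of ascents by at most 1. *)
Lemma ascent_seq_max (w : seq nat) : ascent_seq w -> seq_max w <= asc w.
Proof.
elim/last_ind: w => [_|w a IHw]; first by rewrite /seq_max big_nil.
have [->|w0] := eqVneq w [::].
  by case/andP=> /= /eqP-> _; rewrite /seq_max big_seq1.
rewrite ascent_seq_rcons // => /andP[/IHw le_max le_a].
rewrite asc_rcons // seq_max_rcons; have := last_leq_seq_max w; lia.
Qed.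

Lemma asc_seq_max0 (w : seq nat) : seq_max w = 0 -> asc w = 0.
Proof.
elim/last_ind: w => [_|w a IHw]; first by rewrite /asc big_ord0.
have [->|w0] := eqVneq w [::]; first by rewrite /asc big_ord0.
by rewrite seq_max_rcons asc_rcons // => w_max; rewrite IHw; lia.
Qed.

(** While the maximum is 0 there are no ascents, so the first nonzero letter can only be 1. *)
Lemma ascent_seq_mem1 (w : seq nat) : ascent_seq w -> 0 < seq_max w -> 1 \in w.
Proof.
elim/last_ind: w => [|w a IHw]; first by rewrite /seq_max big_nil.
have [->|w0] := eqVneq w [::].
  by case/andP=> /= /eqP-> _; rewrite /seq_max big_seq1.
rewrite ascent_seq_rcons // seq_max_rcons mem_rcons inE => /andP[/IHw in_w le_a].
have [/asc_seq_max0 asc0|max_gt0] := posnP (seq_max w); last by rewrite in_w ?orbT.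
by rewrite asc0 in le_a; case: a le_a => [|[]].
Qed.

(** Matching [s] from the right leaves a prefix that contains [x]; this prefix is an ascent sequence
    with a nonzero letter, so it contains 1. *)
Lemma ascent_subseq1 (w s : seq nat) (x : nat) :
  ascent_seq w -> 0 < x -> subseq (x :: s) w -> subseq (1 :: s) w.
Proof.
elim/last_ind: w s => [//|w a IHw] s aw x_gt0.
case/lastP: s => [|s y].
  rewrite !sub1seq => /leq_seq_max le_x.
  by rewrite ascent_seq_mem1 // (leq_trans x_gt0).
have [->|w0] := eqVneq w [::].
  by rewrite -rcons_cons (subseq_rcons_rcons _ _ [::]); case: eqP.
move: aw; rewrite ascent_seq_rcons // => /andP[aw _].
by rewrite -!rcons_cons !subseq_rcons_rcons; case: eqP => _; apply: IHw.
Qed.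

(** * Words avoiding 021 *)

Definition weakly_increasing_off0 (w : seq nat) : Prop :=
  forall x y, subseq [:: x; y] w -> 0 < y -> x <= y.

Lemma avoids021_increasing (w : seq nat) :
  head 0 w = 0 -> avoids w [:: 0; 2; 1] -> weakly_increasing_off0 w.
Proof.
move=> w0 av x y sub y_gt0; rewrite leqNgt; apply/negP => lt_yx.
case/negP: av; apply/contains021P; exists 0, x, y; rewrite y_gt0 lt_yx; split=> //.
case: w w0 sub => //= _ w ->; rewrite eqxx.
by have /gtn_eqF-> := ltn_trans y_gt0 lt_yx.
Qed.

Lemma avoids021_rcons (w : seq nat) (a : nat) :
  w != [::] -> head 0 w = 0 ->
  avoids (rcons w a) [:: 0; 2; 1] =
    avoids w [:: 0; 2; 1] && ((a == 0) || (seq_max w <= a)).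
Proof.
move=> w_n0 w0; apply/idP/andP => [av|[av a_ok]].
  split.
    apply: contra av => /contains021P[x [y [z [sub H]]]]; apply/contains021P.
    by exists x, y, z; split=> //; apply: subseq_trans sub (subseq_rcons _ _).
  have [//|a_gt0] := posnP a; apply/seq_max_leqP => x xw.
  apply: (@avoids021_increasing (rcons w a)) => //; first by case: (w) w_n0 w0.
  by rewrite (subseq_rcons_rcons _ [:: x]) eqxx sub1seq.
apply: contra av => /contains021P[x [y [z []]]].
rewrite (subseq_rcons_rcons _ [:: x; y]); case: eqP => [->|_] sub H; last first.
  by apply/contains021P; exists x, y, z.
have /leq_seq_max : y \in w by apply: (mem_subseq sub); rewrite !inE eqxx orbT.
by lia.
Qed.

(** Since nonzero letters increase weakly, the maximum occurs at or after any occurrence of [u]. *)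
Lemma subseq_rcons_seq_max (w s : seq nat) (u : nat) :
  weakly_increasing_off0 w -> 0 < u -> subseq (rcons s u) w ->
  subseq (rcons s (seq_max w)) w.
Proof.
elim/last_ind: w => [|w a IHw] inc u_gt0; first by case: s.
have sub_w : subseq w (rcons w a) := subseq_rcons w a.
rewrite subseq_rcons_rcons; case: eqP => [ua sub|_ sub].
  rewrite seq_max_rcons (maxn_idPr _).
    by rewrite subseq_rcons_rcons eqxx.
  apply/seq_max_leqP => x xw; apply: inc; rewrite -?ua //.
  by rewrite ua (subseq_rcons_rcons _ [:: x]) eqxx sub1seq.
have inc_w : weakly_increasing_off0 w.
  by move=> x y sub_xy; apply: inc; apply: subseq_trans sub_xy sub_w.
rewrite seq_max_rcons; case: leqP => _.
  by rewrite subseq_rcons_rcons eqxx (subseq_prefix _ _ _ _ sub).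
exact: subseq_trans (IHw inc_w u_gt0 sub) sub_w.
Qed.

(** * The automaton and the completions of a word *)

(* st_descended: some 1 is followed by a 0.  st_closed: moreover a maximum
   greater than 1 occurs after such a 0, so that one more 0 creates 1020 and one
   more copy of the maximum creates 1022. *)
Record state := State {
  st_max : nat; st_asc : nat; st_last : nat; st_descended : bool; st_closed : bool }.

Definition state_of (w : seq nat) : state :=
  State (seq_max w) (asc w) (last 0 w) (subseq [:: 1; 0] w)
    ((1 < seq_max w) && subseq [:: 1; 0; seq_max w] w).

(** Meant for admissible letters: a nonzero one is the new maximum, so it closes the word exactly
    when it exceeds 1 and a 1 followed by a 0 came before. *)
Definition step (st : state) (a : nat) : state :=
  let: State m A l d c := st in
  State (maxn m a) (A + (l < a)) a (d || (a == 0) && (0 < m))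
    (if a == 0 then c else d && (1 < a)).

Definition pattern (z : bool) : seq nat :=
  if z then [:: 1; 0; 2; 0] else [:: 1; 0; 2; 2].

(** The guard [0 < m] keeps 0 from being listed twice when the maximum is 0. *)
Definition letters (z : bool) (st : state) : seq nat :=
  let: State m A l d c := st in
  nseq (~~ (z && c)) 0 ++ nseq ((0 < m) && (z || ~~ c)) m ++ iota m.+1 (A.+1 - m).

Definition good (z : bool) (w : seq nat) : bool :=
  [&& ascent_seq w, avoids w [:: 0; 2; 1] & avoids w (pattern z)].

(** A new occurrence ends in [a]. Its first three letters can be changed to 1, 0 and the maximum, so
    [w] is closed; conversely, a closed [w] completes the pattern with 0, respectively with its
    maximum. *)
Lemma avoids_pattern_rcons (z : bool) (w : seq nat) (a : nat) :
  head 0 w = 0 -> ascent_seq w -> avoids w [:: 0; 2; 1] ->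
  (a == 0) || (seq_max w <= a) ->
  avoids (rcons w a) (pattern z) =
    avoids w (pattern z) &&
    ~~ (st_closed (state_of w) && (if z then a == 0 else a == seq_max w)).
Proof.
move=> w0 aw av a_ok; have inc := avoids021_increasing _ w0 av.
have closedP x y u : subseq [:: x; y; u] w -> y < x < u -> y = 0 /\ st_closed (state_of w).
  move=> sub /andP[lt_yx lt_xu].
  have y0 : y = 0.
    (* A positive [y] after [x] would be at least [x]. *)
    have /inc : subseq [:: x; y] w by apply: subseq_trans sub; apply: (prefix_subseq [:: x; y] [:: u]).
    by lia.
  have sub1 : subseq [:: 1; 0; u] w by apply: (ascent_subseq1 _ _ x); rewrite -?y0 //; lia.
  split=> //=; rewrite (subseq_rcons_seq_max _ [:: 1; 0] u) ?andbT //; last by lia.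
  have /leq_seq_max : u \in w by apply: (mem_subseq sub); rewrite !inE eqxx !orbT.
  by lia.
have mono_contains t : contains w t -> contains (rcons w a) t.
  move=> /containsP[s sub sP]; apply/containsP; exists s => //.
  exact: subseq_trans sub (subseq_rcons _ _).
rewrite /avoids -negb_or; congr (~~ _); apply/idP/orP => [|[/mono_contains//|]].
  case: z.
    move=> /contains1020P[x [y [u []]]].
    rewrite (subseq_rcons_rcons _ [:: x; y; u]); case: eqP => [<-|_] sub H.
      by have [-> ->] := closedP _ _ _ sub H; right.
    by left; apply/contains1020P; exists x, y, u.
  move=> /contains1022P[x [y [u []]]].
  rewrite (subseq_rcons_rcons _ [:: x; y; u]); case: eqP => [ua|_] sub H.
    have [_ ->] := closedP _ _ _ sub H; right.
    have /leq_seq_max : u \in w by apply: (mem_subseq sub); rewrite !inE eqxx !orbT.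
    by lia.
  by left; apply/contains1022P; exists x, y, u.
case: z => /= /andP[/andP[max_gt1 sub] /eqP ->].
  apply/contains1020P; exists 1, 0, (seq_max w).
  by rewrite (subseq_rcons_rcons _ [:: 1; 0; seq_max w]) eqxx.
apply/contains1022P; exists 1, 0, (seq_max w).
by rewrite (subseq_rcons_rcons _ [:: 1; 0; seq_max w]) eqxx.
Qed.

Lemma mem_letters (z : bool) (st : state) (a : nat) :
  st_max st <= st_asc st ->
  (st_closed st -> 1 < st_max st) ->
  (a \in letters z st) =
    [&& a <= (st_asc st).+1, (a == 0) || (st_max st <= a) &
        ~~ (st_closed st && (if z then a == 0 else a == st_max st))].
Proof.
case: st => m A l d c /= le_mA c_m; rewrite !mem_cat !mem_nseq mem_iota.
by case: z c c_m => [] [] /=; lia.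
Qed.

Lemma good_rcons (z : bool) (w : seq nat) (a : nat) :
  w != [::] -> head 0 w = 0 ->
  good z (rcons w a) = good z w && (a \in letters z (state_of w)).
Proof.
move=> w_n0 w0; rewrite /good ascent_seq_rcons // avoids021_rcons //.
have [aw|//] := boolP (ascent_seq w).
rewrite mem_letters; [|exact: ascent_seq_max|by case/andP].
have [av|_] := boolP (avoids w [:: 0; 2; 1]); last by rewrite andbF.
have [a_ok|_] := boolP ((a == 0) || (seq_max w <= a)); last by rewrite !andbF.
by rewrite avoids_pattern_rcons //=; rewrite andbCA.
Qed.

Lemma state_of_rcons (z : bool) (w : seq nat) (a : nat) :
  w != [::] -> good z w -> a \in letters z (state_of w) ->
  state_of (rcons w a) = step (state_of w) a.
Proof.
move=> w_n0 /and3P[aw _ _].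
rewrite mem_letters; [|exact: ascent_seq_max|by case/andP].
rewrite /state_of /= => /and3P[_ a_ok _].
rewrite seq_max_rcons asc_rcons // last_rcons; congr (State _ _ _ _ _).
  rewrite (subseq_rcons_rcons _ [:: 1]).
  case: eqVneq => _ /=; last by rewrite orbF.
  rewrite sub1seq.
  have [max0|max_gt0] := posnP (seq_max w).
    rewrite orbF; apply/idP/idP => [/leq_seq_max|]; first by rewrite max0.
    by move/(subseq_prefix _ [:: 1]); rewrite sub1seq.
  by rewrite orbT ascent_seq_mem1.
case: eqP a_ok => [-> _|/eqP a_n0 /= le_a].
  rewrite maxn0; case: leqP => //= max_gt1.
  by rewrite (subseq_rcons_rcons _ [:: 1; 0]); case: eqP max_gt1 => // ->.
by rewrite (maxn_idPr le_a) (subseq_rcons_rcons _ [:: 1; 0]) eqxx andbC.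
Qed.

Fixpoint completions (z : bool) (st : state) (n : nat) : seq (seq nat) :=
  if n is n'.+1 then [seq a :: v | a <- letters z st, v <- completions z (step st a) n']
  else [:: [::]].

Lemma good_catl (z : bool) (w u : seq nat) :
  w != [::] -> head 0 w = 0 -> good z (w ++ u) -> good z w.
Proof.
move=> w_n0 w0; elim/last_ind: u => [|u a IHu]; first by rewrite cats0.
rewrite -rcons_cat good_rcons; first by case/andP=> /IHu.
  by case: (w) w_n0.
by case: (w) w_n0 w0.
Qed.

Lemma mem_completions (z : bool) (w u : seq nat) (n : nat) :
  w != [::] -> head 0 w = 0 -> good z w ->
  (u \in completions z (state_of w) n) = (size u == n) && good z (w ++ u).
Proof.
elim: n w u => [|n IHn] w u w_n0 w0 gw.
  by rewrite inE; case: u => //=; rewrite cats0.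
have rcons_n0 a : rcons w a != [::] by case: (w).
have rcons0 a : head 0 (rcons w a) = 0 by case: (w) w_n0 w0.
apply/allpairsPdep/andP.
  move=> [a [v [a_in v_in ->]]]; move: v_in.
  rewrite -(state_of_rcons z) // IHn // ?good_rcons ?gw // cat_rcons.
  by case/andP=> /eqP <- ->; rewrite /= eqxx.
case: u => [[]|a v] // []; rewrite eqSS -cat_rcons => /eqP szv gwv.
have gwa := good_catl _ _ _ (rcons_n0 a) (rcons0 a) gwv.
have a_in : a \in letters z (state_of w) by move: gwa; rewrite good_rcons // gw.
exists a, v; split=> //.
by rewrite -(state_of_rcons z) // IHn // gwv andbT; apply/eqP.
Qed.

Lemma uniq_letters (z : bool) (st : state) : uniq (letters z st).
Proof.
case: st => m A l d c; rewrite /letters.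
by case: (posnP m) => [->|m_gt0]; case: (~~ _); case: (_ || _);
  rewrite /= ?inE ?mem_iota ?iota_uniq; lia.
Qed.

Lemma uniq_completions (z : bool) (st : state) (n : nat) : uniq (completions z st n).
Proof.
elim: n st => [|n IHn] st //=; apply: allpairs_uniq_dep; first exact: uniq_letters.
  by move=> a _; apply: IHn.
by move=> [a v] [a' v'] _ _ /= [-> ->].
Qed.

Definition nb_completions (z : bool) (st : state) (n : nat) := size (completions z st n).

Lemma nb_completions0 z st : nb_completions z st 0 = 1.
Proof. by []. Qed.

Lemma nb_completionsS z st n :
  nb_completions z st n.+1 = \sum_(a <- letters z st) nb_completions z (step st a) n.
Proof. by rewrite /nb_completions /= size_allpairs_dep sumnE big_map. Qed.

Lemma good0 z : good z [:: 0].
Proof.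
apply/and3P; split.
- by apply/ascent_seqP; split=> //= -[|i].
- by apply/negP => /contains021P[x [y [u [/size_subseq]]]].
by apply/negP; case: z => [/contains1020P|/contains1022P] [x [y [u [/size_subseq]]]].
Qed.

Lemma state_of0 : state_of [:: 0] = State 0 0 0 false false.
Proof. by rewrite /state_of /seq_max big_seq1 /asc big_ord0. Qed.

Lemma b_nb_completions z n :
  b (pattern z) n.+1 = nb_completions z (State 0 0 0 false false) n.
Proof.
rewrite -state_of0 (@card_B _ _ [seq 0 :: u | u <- completions z (state_of [:: 0]) n]).
- by rewrite size_map.
- by rewrite map_inj_uniq ?uniq_completions // => u v [].
move=> w; rewrite /in_B -/(good z w); apply/mapP/andP.
  move=> [u u_in ->]; move: u_in; rewrite mem_completions ?good0 //=.
  by case/andP=> /eqP-> ->.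
case: w => [[]|a u] // [sz_u gu].
have a0 : a = 0 by case/and3P: gu => /andP[/eqP].
exists u; last by rewrite a0.
by rewrite mem_completions ?good0 //; apply/andP; rewrite a0 in gu.
Qed.

Lemma b_pattern0 z : b (pattern z) 0 = 1.
Proof.
rewrite (@card_B _ _ [:: [::]]) // => w; rewrite inE /in_B -/(good z w).
case: w => //=; symmetry; apply/and3P; split.
- by apply/ascent_seqP; split=> //= -[|i].
- by apply/negP => /contains021P[x [y [u []]]].
by apply/negP; case: z => [/contains1020P|/contains1022P] [x [y [u []]]].
Qed.

(** * The linear system for the numbers of completions *)

Lemma nb_completions_letters (z : bool) (m A l : nat) (d c : bool) (n : nat) :
  let st := State m A l d c in
  nb_completions z st n.+1 =
    (~~ (z && c)) * nb_completions z (step st 0) n +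
    ((0 < m) && (z || ~~ c)) * nb_completions z (step st m) n +
    \sum_(i < A.+1 - m) nb_completions z (step st (m.+1 + i)) n.
Proof.
move=> st; rewrite nb_completionsS /letters /st !big_cat /= addnA.
congr (_ + _ + _).
- by case: (~~ _); rewrite /= ?big_seq1 ?mul1n ?big_nil.
- by case: (_ && _); rewrite /= ?big_seq1 ?mul1n ?big_nil.
by rewrite -[in iota _ _](addn0 m.+1) iotaDl big_map -{1}(subn0 (A.+1 - m)) big_mkord.
Qed.

(* The index s is the slack asc - max of a closed word.  As power series,
   slack_count s = (1 - x)^s / (1 - 2 x)^(s+1). *)
Fixpoint slack_count (s n : nat) : nat :=
  if n is n'.+1 then slack_count s n' + \sum_(i < s.+1) slack_count (s - i) n' else 1.

Lemma slack_countS (s n : nat) :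
  slack_count s n.+1 = slack_count s n + \sum_(i < s.+1) slack_count (s - i) n.
Proof. by []. Qed.

Lemma slack_count0S (n : nat) : slack_count 0 n.+1 = 2 * slack_count 0 n.
Proof. by rewrite slack_countS big_ord1 mul2n addnn. Qed.

(** The sums in the recurrences for [s.+1] and [s] differ by one term. In series, (1 - 2x) T_(s+1) =
    (1 - x) T_s. *)
Lemma slack_countSS (s n : nat) :
  slack_count s.+1 n.+1 + slack_count s n = slack_count s n.+1 + 2 * slack_count s.+1 n.
Proof.
rewrite !slack_countS big_ord_recl subn0 /=.
under eq_bigr => i _ do rewrite subSS.
lia.
Qed.

(* The one letter that keeps a closed state unchanged is the maximum for 1020 and
   0 for 1022: this is the only difference between the two patterns. *)
Lemma nb_completions_closed (z : bool) (m s l n : nat) :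
  1 < m -> (l == m) || (l == 0) && ~~ z ->
  nb_completions z (State m (m + s) l true true) n = slack_count s n.
Proof.
move=> m_gt1; have m_gt0 := ltnW m_gt1.
elim: n m s l m_gt1 m_gt0 => [//|n IHn] m s l m_gt1 m_gt0 l_ok.
rewrite nb_completions_letters slack_countS; congr (_ + _).
  rewrite /= m_gt0 (gtn_eqF m_gt0) maxnn maxn0 m_gt1.
  (* For 1020 the last letter is [m], so repeating it adds no ascent; for 1022 the letter 0 never
     adds one. *)
  case: z l_ok IHn => l_ok IHn /=.
    move: l_ok; rewrite andbF orbF => /eqP ->.
    by rewrite ltnn addn0 mul0n add0n mul1n IHn ?eqxx.
  by rewrite addn0 mul0n addn0 mul1n IHn ?eqxx ?orbT.
(* The letter [m.+1 + i] adds one ascent and raises the maximum by [i.+1], so the slack drops to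
   [s - i]. *)
rewrite -addnS addKn; apply: eq_bigr => i _ /=.
rewrite (maxn_idPr _); last by lia.
have -> : l < m.+1 + i by lia.
have -> : 1 < m.+1 + i by lia.
have -> : m + s + true = m.+1 + i + (s - i) by have := ltn_ord i; lia.
by rewrite IHn ?eqxx //; lia.
Qed.

(* A word over {0, 1} in which a 1 is followed by a 0, with s + 1 ascents, and
   ending in 0 or in 1 respectively. *)
Definition binary0_count (z : bool) (s n : nat) : nat :=
  nb_completions z (State 1 s.+1 0 true false) n.
Definition binary1_count (z : bool) (s n : nat) : nat :=
  nb_completions z (State 1 s.+1 1 true false) n.

(** The letter [2 + i] closes the word with slack [s - i], so the sum is the one in the recurrence
    of [slack_count s]. *)
Lemma sum_binary_to_closed (z : bool) (s l n : nat) : l <= 1 ->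
  \sum_(i < s.+2 - 1) nb_completions z (step (State 1 s.+1 l true false) (2 + i)) n +
    slack_count s n = slack_count s n.+1.
Proof.
move=> le_l; rewrite slack_countS addnC subn1 /=; congr (_ + _); apply: eq_bigr => i _ /=.
rewrite (maxn_idPr _) //.
have -> : l < 2 + i by lia.
have -> : s.+1 + true = 2 + i + (s - i) by have := ltn_ord i; lia.
by rewrite nb_completions_closed ?eqxx.
Qed.

Lemma binary0_countS (z : bool) (s n : nat) :
  binary0_count z s n.+1 + slack_count s n =
    binary0_count z s n + binary1_count z s.+1 n + slack_count s n.+1.
Proof.
rewrite /binary0_count nb_completions_letters -addnA sum_binary_to_closed //.
by rewrite andbF orbT !mul1n /= addn0 addn1.
Qed.

Lemma binary1_countS (z : bool) (s n : nat) :
  binary1_count z s n.+1 + slack_count s n =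
    binary0_count z s n + binary1_count z s n + slack_count s n.+1.
Proof.
rewrite /binary1_count nb_completions_letters -addnA sum_binary_to_closed //.
by rewrite andbF orbT !mul1n /= addn0.
Qed.

(* With U, V, T the series of binary0_count z s, binary1_count z s and
   slack_count s: (1 - 3x + x^2) U = (1 - x)^2 T and (1 - 3x + x^2) V = (1 - 2x) T.
   The equations for slack s involve slack s + 1, so the induction on the
   coefficient is uniform in s. *)
Lemma binary_count_rec (z : bool) (s n : nat) :
  binary0_count z s n.+2 + binary0_count z s n + 2 * slack_count s n.+1 =
    3 * binary0_count z s n.+1 + slack_count s n.+2 + slack_count s n /\
  binary1_count z s n.+2 + binary1_count z s n + 2 * slack_count s n.+1 =
    3 * binary1_count z s n.+1 + slack_count s n.+2.
Proof.
have U := binary0_countS z; have V := binary1_countS z; have T := slack_countSS.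
elim: n s => [|n IHn] s.
  have := U s 0; have := U s 1; have := V s 0; have := V s 1; have := V s.+1 0.
  have := T s 0; rewrite /binary0_count /binary1_count /= !nb_completions0; lia.
have := U s n.+2; have := U s n.+1; have := U s n.
have := V s n.+2; have := V s n.+1; have := V s n.
(* The equation for [binary0_count z s] involves [binary1_count z s.+1], hence the second
   instance. *)
have [] := IHn s; have [_] := IHn s.+1; have := T s n.+1.
lia.
Qed.

Lemma slack_count1S (n : nat) : slack_count 1 n.+1 = 2 * slack_count 1 n + slack_count 0 n.
Proof. by have := slack_countSS 0 n; rewrite slack_count0S; lia. Qed.

(** Appending 0 keeps the state, [m] gives a closed word of slack 1 and [m.+1] one of slack 0: this
    is the recurrence of [slack_count 1]. *)
Lemma nb_completions_zero_run (z : bool) (m n : nat) : 1 < m ->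
  nb_completions z (State m m 0 true false) n = slack_count 1 n.
Proof.
move=> m_gt1; elim: n => [//|n IHn]; rewrite slack_count1S.
rewrite nb_completions_letters subSnn big_ord1 andbF orbT !addn0 /=.
rewrite (ltnW m_gt1) !mul1n maxn0 maxnn addn0 IHn (gtn_eqF (ltnW m_gt1)) m_gt1.
rewrite -[nat_of_bool true]/1 nb_completions_closed ?eqxx // (maxn_idPr _) // ltnS (ltnW m_gt1).
have -> : m + 1 = m.+1 + 0 by lia.
by rewrite nb_completions_closed ?eqxx //; lia.
Qed.

(** Counts completions of a weakly increasing word with maximum and number of ascents equal to some
    m > 1: the letters m and m + 1 preserve this form, and 0 starts a run of zeros. *)
Fixpoint increasing_count (n : nat) : nat :=
  if n is n'.+1 then slack_count 1 n' + 2 * increasing_count n' else 1.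

Lemma increasing_countS (n : nat) :
  increasing_count n.+1 = slack_count 1 n + 2 * increasing_count n.
Proof. by []. Qed.

Lemma nb_completions_increasing (z : bool) (m n : nat) : 1 < m ->
  nb_completions z (State m m m false false) n = increasing_count n.
Proof.
elim: n m => [//|n IHn] m m_gt1; rewrite increasing_countS.
rewrite nb_completions_letters subSnn big_ord1 andbF orbT !addn0 /=.
rewrite (ltnW m_gt1) !mul1n maxn0 maxnn ltnn addn0 (gtn_eqF (ltnW m_gt1)).
rewrite nb_completions_zero_run // IHn // (maxn_idPr _) // ltnSn addn1 IHn; last by lia.
by lia.
Qed.

(** Moving [binary1_count] to the left and [slack_count 1] to the right, both sides grow by
    [increasing_count n - slack_count 0 n] at each step. *)
Lemma nb_completions_ones (z : bool) (n : nat) :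
  nb_completions z (State 1 1 1 false false) n + slack_count 1 n =
    binary1_count z 0 n + increasing_count n.
Proof.
elim: n => [//|n IHn]; rewrite slack_count1S increasing_countS.
rewrite nb_completions_letters subSnn big_ord1 andbF orbT !mul1n.
have := binary1_countS z 0 n; rewrite slack_count0S.
have -> : step (State 1 1 1 false false) 0 = State 1 1 0 true false by [].
have -> : step (State 1 1 1 false false) 1 = State 1 1 1 false false by [].
have -> : step (State 1 1 1 false false) (2 + 0) = State 2 2 2 false false by [].
rewrite (nb_completions_increasing z 2 n isT) -/(binary0_count z 0 n); lia.
Qed.

Lemma nb_completions_zeros (z : bool) (n : nat) :
  nb_completions z (State 0 0 0 false false) n.+1 =
    nb_completions z (State 0 0 0 false false) n + nb_completions z (State 1 1 1 false false) n.
Proof.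
by rewrite nb_completions_letters big_ord1 andbF mul1n addn0.
Qed.

(** * The recurrence for [b] and the generating function *)

(** At slack 0 the inhomogeneous terms cancel, because [slack_count 0] doubles at each step. *)
Lemma binary1_count0_rec (z : bool) (n : nat) :
  binary1_count z 0 n.+2 + binary1_count z 0 n = 3 * binary1_count z 0 n.+1.
Proof. by have [_] := binary_count_rec z 0 n; rewrite !slack_count0S; lia. Qed.

(** The coefficients are those of the expanded denominator. The factor 1 - x comes from
    [nb_completions_zeros], 1 - 3x + x^2 from [binary1_count z 0], and (1 - 2x)^3 from
    [increasing_count]. The smallest index is [n.+1] because the numerator has degree 6. *)
Lemma b_rec (z : bool) (n : nat) :
  let f := b (pattern z) in
  f n.+4.+3 + 40 * f n.+4.+1 + 86 * f n.+3 + 8 * f n.+1 =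
    10 * f n.+4.+2 + 81 * f n.+4 + 44 * f n.+2.
Proof.
have I k := nb_completions_ones z k; have V k := binary1_count0_rec z k.
rewrite /= !b_nb_completions !nb_completions_zeros.
move: (I n) (I n.+1) (I n.+2) (I n.+3) (I n.+4) (I n.+4.+1).
move: (V n) (V n.+1) (V n.+2) (V n.+3).
rewrite !(increasing_countS, slack_count1S, slack_count0S).
lia.
Qed.

Lemma b_initial (z : bool) : [seq b (pattern z) n | n <- iota 0 7] = [:: 1; 1; 2; 5; 14; 41; 120].
Proof.
have I k := nb_completions_ones z k; have V k := binary1_count0_rec z k.
rewrite /= b_pattern0 !b_nb_completions !nb_completions_zeros !nb_completions0.
move: (I 1) (I 2) (I 3) (I 4) (V 0) (V 1) (V 2) (binary1_countS z 0 0).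
rewrite !(increasing_countS, slack_count1S, slack_count0S) /binary0_count.
rewrite /= [binary1_count z 0 0]nb_completions0 !nb_completions0 => *.
by congr [:: _; _; _; _; _; _; _]; lia.
Qed.

Local Open Scope ring_scope.

Lemma denominatorE :
  (1 - 'X) * (1 - 2%:R *: 'X) ^+ 3 * (1 - 3%:R *: 'X + 'X^2) =
    Poly [:: 1; - 10%:R; 40%:R; - 81%:R; 86%:R; - 44%:R; 8%:R] :> {poly rat}.
Proof.
rewrite /= !cons_poly_def -!mul_polyC !(polyCN, polyC_natr, polyC1) mul0r add0r.
ring.
Qed.

Lemma numeratorE :
  1 - 9%:R *: 'X + 32%:R *: 'X^2 - 56%:R *: 'X^3 + 49%:R *: 'X^4 - 19%:R *: 'X^5 + 'X^6 =
    Poly [:: 1; - 9%:R; 32%:R; - 56%:R; 49%:R; - 19%:R; 1] :> {poly rat}.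
Proof.
rewrite /= !cons_poly_def -!mul_polyC !(polyCN, polyC_natr, polyC1) mul0r add0r.
ring.
Qed.

Theorem theorem2p9 (tau : seq nat)
  (htau : tau = [:: 1; 0; 2; 0]%N \/ tau = [:: 1; 0; 2; 2]%N) :
  f_gen tau =1
    fps_div
      (fps_of_poly
        (1 - 9%:R *: 'X + 32%:R *: 'X^2 - 56%:R *: 'X^3 + 49%:R *: 'X^4
           - 19%:R *: 'X^5 + 'X^6))
      (fps_of_poly
        ((1 - 'X) * (1 - 2%:R *: 'X) ^+ 3 * (1 - 3%:R *: 'X + 'X^2))).
Proof.
have [z ->] : exists z, tau = pattern z by case: htau => ->; [exists true | exists false].
rewrite denominatorE numeratorE; apply/fps_divP; first by rewrite /fps_of_poly coef_Poly.
move=> n; rewrite /fps_mul /fps_of_poly coef_Poly.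
under eq_bigr do rewrite coef_Poly.
have [lt_n7|le7n] := ltnP n 7.
  have [f0 f1 f2 f3 f4 f5 f6] := b_initial z.
  do 7?[case: n lt_n7 => [_|n lt_n7]] => //;
    by rewrite !big_ord_recr big_ord0 /= /f_gen ?f0 ?f1 ?f2 ?f3 ?f4 ?f5 ?f6; ring.
rewrite [RHS]nth_default // -(subnK le7n); move: (n - 7)%N => m.
(* The last eight terms of the convolution are split off; the others vanish, since the denominator
   has degree 6. *)
rewrite addnC -[(7 + m)%N]/m.+4.+3 !big_ord_recr big1 => [|i _]; last first.
  by rewrite [X in _ * X]nth_default ?mulr0 //=; have := ltn_ord i; lia.
have sub k : (k + m - m)%N = k by rewrite addnK.
rewrite /= !subSS (sub 0) (sub 1) (sub 2) (sub 3) (sub 4) (sub 5) (sub 6) (sub 7) /= /f_gen.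
have /(congr1 (fun k => k%:R : rat)) := b_rec z m.
rewrite !(natrD, natrM) => rec; lra.
Qed.
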